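(* Assume that the following negative correlation property holds: for every finite graph, every $\beta>0$, all distinct edges $e_1,\dots,e_n$ of the graph and all $1\le m<n$, $$\mathbb{P}_\beta[e_1,\dots,e_n]\le\mathbb{P}_\beta[e_1,\dots,e_m]\;\mathbb{P}_\beta[e_{m+1},\dots,e_n],$$ where $\mathbb{P}_\beta$ is the arboreal gas on that graph and $\mathbb{P}_\beta[e_1,\dots,e_k]$ is the probability that the edges $e_1,\dots,e_k$ are all in the forest. Let $\beta>0$, let $\Lambda_n$ be an increasing family of finite subgraphs with $\Lambda_n\uparrow\mathbb{Z}^d$, and let $\mathbb{P}_{\beta,n}$ be the arboreal gas with parameter $\beta$ on $\Lambda_n$. Then the weak limit $\lim_{n\to\infty}\mathbb{P}_{\beta,n}$ exists and is translation invariant.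
   Context: On a finite graph, a forest is an acyclic subgraph $F$ containing all vertices; $|F|$ is its number of edges. The arboreal gas with parameter $\beta>0$ is the probability measure on forests with $\mathbb{P}_\beta[F]\propto\beta^{|F|}$. $\mathbb{Z}^d$ is the nearest-neighbour lattice. The finite subgraphs $\Lambda_n$ are connected subgraphs of $\mathbb{Z}^d$ induced by finite vertex sets; $\Lambda_n\uparrow\mathbb{Z}^d$ means that these vertex sets are increasing and that every finite $A\subset\mathbb{Z}^d$ is contained in $\Lambda_n$ for all large $n$. The measures $\mathbb{P}_{\beta,n}$ are regarded as measures on $\{0,1\}^{E(\mathbb{Z}^d)}$ by declaring edges outside $\Lambda_n$ absent. *)

(* Defs.v *)
From HB Require Import structures.
From mathcomp Require Import all_boot all_order all_algebra finmap.
From mathcomp Require Import all_classical all_reals all_analysis.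

Set Implicit Arguments.
Unset Strict Implicit.
Unset Printing Implicit Defensive.

Import Order.TTheory GRing.Theory Num.Theory.
Import numFieldNormedType.Exports.

Local Open Scope classical_set_scope.
Local Open Scope ring_scope.

Record sgraph := SGraph {
  vertex :> finType;
  adj : rel vertex;
  adj_sym : symmetric adj;
  adj_irr : irreflexive adj
}.

Definition edges (G : sgraph) : {set {set G}} :=
  [set e | [exists x : G, exists y : G, adj x y && (e == [set x; y]%SET)]]%SET.

Definition graph_connected (G : sgraph) : Prop :=
  forall x y : G, connect (@adj G) x y.

(* The subgraphs of [G] that contain all the vertices of [G], given by their
   edge sets; an arbitrary set of sets of vertices is allowed in the type, and
   [is_forest] requires it to consist of edges of [G]. *)
Definition subgraph (G : sgraph) : Type := {set {set G}}.

HB.instance Definition _ (G : sgraph) := Finite.on (subgraph G).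
HB.instance Definition _ (G : sgraph) :=
  isPointed.Build (subgraph G) (finset.set0 : {set {set G}}).
HB.instance Definition _ (G : sgraph) :=
  @isMeasurable.Build default_measure_display (subgraph G) discrete_measurable
    discrete_measurable0 discrete_measurableC discrete_measurableU.

(* A cycle is a cyclic sequence of at least 3 distinct vertices in which
   cyclically consecutive vertices are joined by an edge of [F]. *)
Definition is_cycle (G : sgraph) (F : {set {set G}}) (c : seq G) : bool :=
  (2 < size c)%N && ucycleb (fun x y => [set x; y]%SET \in F) c.

Definition is_forest (G : sgraph) (F : subgraph G) : bool :=
  ((F : {set {set G}}) \subset edges G) && `[< forall c, ~~ is_cycle F c >].

Section arboreal_gas.
Context {R : realType} (G : sgraph) (beta : {posnum R}).

Definition gas_weight (F : subgraph G) : R :=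
  if is_forest F then beta%:num ^+ #|(F : {set {set G}})| else 0.

Definition gas_partition : R := \sum_(F : subgraph G) gas_weight F.

Definition arboreal_gas (A : set (subgraph G)) : \bar R :=
  ((\sum_(F : subgraph G | F \in A) gas_weight F) / gas_partition)%:E.

Lemma gas_weight_ge0 F : 0 <= gas_weight F.
Proof. by rewrite /gas_weight; case: ifP => // _; rewrite exprn_ge0. Qed.

Lemma is_forest0 : is_forest (finset.set0 : subgraph G).
Proof.
rewrite /is_forest finset.sub0set /=; apply/asboolP => c; apply/negP.
by case: c => [|x [|y c]] //= /andP[_ /andP[/= /andP[]]]; rewrite finset.in_set0.
Qed.

Lemma gas_partition_gt0 : 0 < gas_partition.
Proof.
rewrite /gas_partition (bigD1 (finset.set0 : subgraph G)) //=.
rewrite ltr_pwDl ?sumr_ge0 // => [|F _]; last exact: gas_weight_ge0.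
by rewrite /gas_weight is_forest0 exprn_gt0.
Qed.

Let gas_prob_ge0 F : 0 <= gas_weight F / gas_partition.
Proof. by rewrite divr_ge0 ?gas_weight_ge0 // ltW ?gas_partition_gt0. Qed.

Let gas_mixture : {measure set (subgraph G) -> \bar R} :=
  msum (fun k => let F := nth point (index_enum (subgraph G)) k in
          mscale (NngNum (gas_prob_ge0 F)) (dirac F))
       (size (index_enum (subgraph G))).

Let arboreal_gasE : arboreal_gas = gas_mixture.
Proof.
apply/funext => A; pose r := index_enum (subgraph G).
transitivity (\sum_(F <- r) (gas_weight F / gas_partition)%:E * \d_F A)%E.
  rewrite /arboreal_gas mulr_suml big_mkcond /= -sumEFin.
  by apply: eq_bigr => F _; rewrite diracE; case: ifP; rewrite ?mule1 ?mule0.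
by rewrite (big_nth point) big_mkord.
Qed.

Let gas0 : arboreal_gas set0 = 0%E.
Proof. by rewrite arboreal_gasE measure0. Qed.

Let gas_ge0 A : (0 <= arboreal_gas A)%E.
Proof. by rewrite arboreal_gasE measure_ge0. Qed.

Let gas_sigma_additive : semi_sigma_additive arboreal_gas.
Proof. by rewrite arboreal_gasE; exact: measure_semi_sigma_additive. Qed.

HB.instance Definition _ :=
  isMeasure.Build _ _ _ arboreal_gas gas0 gas_ge0 gas_sigma_additive.

Let gas_setT : arboreal_gas setT = 1%E.
Proof.
rewrite /arboreal_gas (eq_bigl xpredT) => [|F]; last by rewrite in_setT.
by rewrite divff // gt_eqF // gas_partition_gt0.
Qed.

HB.instance Definition _ :=
  Measure_isProbability.Build _ _ _ arboreal_gas gas_setT.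

End arboreal_gas.

Definition all_present (G : sgraph) (s : seq {set G}) : set (subgraph G) :=
  [set F | {subset s <= (F : {set {set G}})}].

Definition negative_correlation (R : realType) : Prop :=
  forall (G : sgraph) (beta : {posnum R}) (e : seq {set G}) (m : nat),
    uniq e -> {subset e <= edges G} -> (1 <= m < size e)%N ->
    (arboreal_gas beta (all_present e) <=
     arboreal_gas beta (all_present (take m e)) *
     arboreal_gas beta (all_present (drop m e)))%E.

Definition lattice_adj (d : nat) (x y : 'rV[int]_d) : bool :=
  \sum_(i < d) `|x ord0 i - y ord0 i| == 1.

Lemma lattice_adj_sym d : symmetric (@lattice_adj d).
Proof.
by move=> x y; congr (_ == _); apply: eq_bigr => i _; rewrite distrC.
Qed.

Lemma lattice_adj_irr d : irreflexive (@lattice_adj d).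
Proof.
move=> x; rewrite /lattice_adj big1 // => i _.
by rewrite subrr normr0.
Qed.

Lemma lattice_adjD d (v x y : 'rV[int]_d) :
  lattice_adj (v + x) (v + y) = lattice_adj x y.
Proof.
congr (_ == _); apply: eq_bigr => i _; congr `|_|.
by rewrite !mxE opprD addrACA subrr add0r.
Qed.

Definition is_lattice_edge (d : nat) (e : {fset 'rV[int]_d}) : bool :=
  [exists x : e, exists y : e,
     lattice_adj (val x) (val y) && (e == [fset val x; val y]%fset)].

Lemma is_lattice_edgeP d (e : {fset 'rV[int]_d}) :
  reflect (exists x y, lattice_adj x y /\ e = [fset x; y]%fset)
          (is_lattice_edge e).
Proof.
apply: (iffP existsP) => [[x /existsP[y /andP[xy /eqP ->]]]|[x [y [xy ->]]]].
  by exists (val x), (val y).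
exists [` fset21 x y]%fset; apply/existsP; exists [` fset22 x y]%fset.
by rewrite /= xy eqxx.
Qed.

Definition lattice_edge (d : nat) : Type :=
  {e : {fset 'rV[int]_d} | is_lattice_edge e}.

HB.instance Definition _ (d : nat) := SubChoice.on (lattice_edge d).

Lemma shift_edge_subproof d (v : 'rV[int]_d) (e : lattice_edge d) :
  is_lattice_edge [fset (v + x)%R | x in val e]%fset.
Proof.
case: e => e /= /is_lattice_edgeP[x [y [xy ->]]].
apply/is_lattice_edgeP; exists (v + x), (v + y); rewrite lattice_adjD.
by split=> //; rewrite imfsetU !imfset_fset1.
Qed.

Definition shift_edge (d : nat) (v : 'rV[int]_d) (e : lattice_edge d) :
  lattice_edge d :=
  exist (@is_lattice_edge d) _ (shift_edge_subproof v e).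

(* The sigma-algebra on configurations is the Borel one, generated by the open
   sets of the product topology. *)
Definition config (d : nat) : Type := {ptws lattice_edge d -> bool}.

HB.instance Definition _ (d : nat) := Pointed.on (config d).
HB.instance Definition _ (d : nat) := Topological.on (config d).
HB.instance Definition _ (d : nat) :=
  @isMeasurable.Build (sigma_display (@open (config d))) (config d)
    <<s (@open (config d)) >> (@sigma_algebra0 _ setT _) (@sigma_algebraC _ _)
    (@sigma_algebra_bigcup _ setT _).

Definition shift_config (d : nat) (v : 'rV[int]_d) (w : config d) : config d :=
  fun e => w (shift_edge v e).

Definition translation_invariant (R : realType) (d : nat)
    (P : probability (config d) R) : Prop :=
  forall (v : 'rV[int]_d) (A : set (config d)), measurable A ->
    P (shift_config v @^-1` A) = P A.

Definition weak_cvg (R : realType) (d : nat)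
    (Pn : nat -> probability (config d) R) (P : probability (config d) R) :
    Prop :=
  forall f : config d -> R, continuous f -> bounded_fun f ->
    (\int[Pn n]_w (f w))%R @[n --> \oo] --> (\int[P]_w (f w))%R.

Section induced_subgraph.
Context (d : nat) (L : {fset 'rV[int]_d}).

Definition induced_adj (x y : L) : bool := lattice_adj (val x) (val y).

Lemma induced_adj_sym : symmetric induced_adj.
Proof. by move=> x y; exact: lattice_adj_sym. Qed.

Lemma induced_adj_irr : irreflexive induced_adj.
Proof. by move=> x; exact: lattice_adj_irr. Qed.

Definition induced_sgraph : sgraph := SGraph induced_adj_sym induced_adj_irr.

(* An edge of the lattice is present in the configuration of [F] iff it is the
   image of an edge of [F]; in particular edges outside [L] are absent. *)
Definition config_of (F : subgraph induced_sgraph) : config d :=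
  fun e => [exists f : {set L}, (f \in (F : {set {set L}})) &&
             (val e == [fset val x | x in f]%fset)].

Lemma measurable_config_of : measurable_fun setT config_of.
Proof. by []. Qed.

HB.instance Definition _ :=
  isMeasurableFun.Build _ _ _ _ config_of measurable_config_of.

End induced_subgraph.

Definition lattice_gas (R : realType) (d : nat) (beta : {posnum R})
    (L : {fset 'rV[int]_d}) : probability (config d) R :=
  distribution (arboreal_gas beta) (@config_of d L).

(* Main.v *)
(* Deleting an edge of a graph amounts to conditioning the gas on the absence of
   that edge, which by negative correlation can only increase the probability
   that given other edges are present.  So for an injective graph morphism h
   from G to H, the edges h(S) are present in the gas on H with probability at
   most that of S in the gas on G.  Along an increasing family of boxes the
   probabilities that a finite set S of lattice edges is present thus decrease,
   and they converge.  By inclusion-exclusion the probabilities of all cylinders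
   converge; compactness makes the limit sigma-additive on cylinders, and it
   extends to a Borel probability, to which the measures converge weakly because
   continuous functions are uniform limits of functions of finitely many edges.
   Since every translate of a box is contained in a later box, the limit
   satisfies P(v + S) <= P(S) for all v, hence P(v + S) = P(S). *)

Require Import Defs.
From HB Require Import structures.
From mathcomp Require Import all_boot all_order all_algebra finmap.
From mathcomp Require Import all_classical all_reals all_analysis.
From mathcomp Require Import lra.

Set Implicit Arguments.
Unset Strict Implicit.
Unset Printing Implicit Defensive.

Import Order.TTheory GRing.Theory Num.Theory.
Import numFieldNormedType.Exports.

Local Open Scope classical_set_scope.
Local Open Scope ring_scope.

(** * Monotonicity of the gas *)

Section edge_deletion.
Context (R : realType) (G : sgraph) (beta : {posnum R}).
Implicit Types (D : {set {set G}}) (S : seq {set G}) (f : {set G}).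

(** Deletion keeps the vertex type, so subgraphs before and after it have the same type and their
    weights compare directly. *)
Definition del_adj D (x y : G) := adj x y && ([set x; y]%SET \notin D).

Lemma del_adj_sym D : symmetric (del_adj D).
Proof. by move=> x y; rewrite /del_adj adj_sym finset.setUC. Qed.

Lemma del_adj_irr D : irreflexive (del_adj D).
Proof. by move=> x; rewrite /del_adj adj_irr. Qed.

Definition del_graph D : sgraph := SGraph (del_adj_sym D) (del_adj_irr D).

Lemma edgesP (H : sgraph) (e : {set H}) :
  reflect (exists x y : H, adj x y /\ e = [set x; y]%SET) (e \in edges H).
Proof.
rewrite finset.inE; apply: (iffP existsP) => [[x /existsP[y /andP[xy /eqP ->]]]|].
  by exists x, y.
by move=> [x [y [xy ->]]]; exists x; apply/existsP; exists y; rewrite xy eqxx.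
Qed.

Lemma edges_del D : edges (del_graph D) = (edges G :\: D)%SET.
Proof.
apply/finset.setP => e; rewrite finset.in_setD; apply/idP/andP.
  move=> /(@edgesP (del_graph D))[x [y [/andP[xy xyD] ->]]]; split=> //.
  by apply/(@edgesP G); exists x, y.
move=> [eD /(@edgesP G)[x [y [xy eE]]]]; apply/(@edgesP (del_graph D)).
by exists x, y; rewrite /= /del_adj xy -eE.
Qed.

Lemma gas_weight_del D (F : {set {set G}}) :
  gas_weight beta (F : subgraph (del_graph D)) =
  if [disjoint F & D]%B then gas_weight beta (F : subgraph G) else 0.
Proof.
rewrite /gas_weight /is_forest edges_del finset.subsetD.
by case: [disjoint F & D]%B; rewrite ?andbT ?andbF.
Qed.

(** Unnormalised probability in [del_graph D], written as a sum over forests of [G] itself; with [S]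
    empty it is the partition function of [del_graph D]. *)
Definition gas_mass D S : R :=
  \sum_(F : subgraph G | [disjoint (F : {set {set G}}) & D]%B &&
      all (mem (F : {set {set G}})) S) gas_weight beta F.

Lemma arboreal_gas_del D S :
  arboreal_gas beta (@all_present (del_graph D) S) =
  (gas_mass D S / gas_mass D [::])%:E.
Proof.
rewrite /arboreal_gas /gas_partition; congr ((_ / _)%:E).
  rewrite /gas_mass [RHS]big_mkcondl.
  apply: eq_big => [F|F _]; last exact: gas_weight_del.
  apply/idP/allP => [|h]; first by rewrite inE.
  by rewrite inE.
rewrite /gas_mass [RHS]big_mkcondl.
by apply: eq_big => [//|F _]; exact: gas_weight_del.
Qed.

Lemma arboreal_gasE S :
  arboreal_gas beta (all_present S) =
  (gas_mass finset.set0 S / gas_mass finset.set0 [::])%:E.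
Proof.
rewrite /arboreal_gas /gas_partition; congr ((_ / _)%:E); apply: eq_bigl => F;
  rewrite finset.disjoints_subset finset.setC0 finset.subsetT //=.
by apply/idP/allP; rewrite inE.
Qed.

Lemma gas_mass_gt0 D : 0 < gas_mass D [::].
Proof.
rewrite /gas_mass (bigD1 (finset.set0 : subgraph G)) /=; last first.
  by rewrite andbT finset.disjoints_subset finset.sub0set.
rewrite ltr_pwDl ?sumr_ge0 // => [|F _]; last exact: gas_weight_ge0.
by rewrite /gas_weight is_forest0 exprn_gt0.
Qed.

Lemma gas_mass_split D S f : f \notin D ->
  gas_mass D S = gas_mass D (f :: S) + gas_mass (f |: D)%SET S.
Proof.
move=> fD; rewrite /gas_mass.
rewrite (bigID (fun F : subgraph G => f \in (F : {set {set G}}))).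
congr (_ + _); apply: eq_bigl => F /=; first by rewrite -andbA [X in _ && X]andbC.
rewrite !finset.disjoints_subset finset.setCU finset.subsetI.
by rewrite [in RHS]finset.subsetC finset.sub1set finset.in_setC andbC andbA.
Qed.

(* Negative correlation on [del_graph D] compares [f] present with the average,
   hence, by complementation, [f] absent with the average. *)
Lemma gas_mass_del1 (nc : negative_correlation R) D S f :
  uniq S -> {subset S <= (edges G :\: D)%SET} ->
  f \in edges G -> f \notin D -> f \notin S ->
  gas_mass D S / gas_mass D [::] <=
  gas_mass (f |: D)%SET S / gas_mass (f |: D)%SET [::].
Proof.
move=> uS SG fG fD fS.
rewrite ler_pdivrMr ?gas_mass_gt0// mulrAC ler_pdivlMr ?gas_mass_gt0//.
have [->|S0] := eqVneq S [::]; first by rewrite mulrC.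
have : gas_mass D (f :: S) * gas_mass D [::] <= gas_mass D [:: f] * gas_mass D S.
  have fSG : {subset f :: S <= (edges G :\: D)%SET}.
    by move=> e; rewrite inE => /predU1P[->|/SG//]; rewrite finset.inE fD.
  have := nc (del_graph D) beta (f :: S) 1%N.
  rewrite /= fS uS take0 drop0 edges_del ltnS lt0n size_eq0 S0.
  move=> /(_ isT fSG isT); rewrite !arboreal_gas_del -EFinM lee_fin.
  have Z0 := gas_mass_gt0 D; rewrite -(ler_pM2r (mulr_gt0 Z0 Z0)).
  set Z := gas_mass D [::] in Z0 *.
  by rewrite mulf_div divfK ?mulf_neq0 ?gt_eqF// mulrA divfK// gt_eqF.
(* After splitting on the presence of [f], hypothesis and goal both reduce to [gas_mass D (f :: S) *
   m <= gas_mass D [:: f] * mS]. *)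
have := gas_mass_split S fD; have := gas_mass_split [::] fD.
set m := gas_mass (f |: D)%SET [::]; set mS := gas_mass (f |: D)%SET S.
by move=> -> ->; nra.
Qed.

(** The edges of [D] are deleted one at a time, each deletion being an instance of
    [gas_mass_del1]. *)
Lemma gas_mass_del (nc : negative_correlation R) D S :
  uniq S -> {subset S <= (edges G :\: D)%SET} -> D \subset edges G ->
  gas_mass finset.set0 S / gas_mass finset.set0 [::] <=
  gas_mass D S / gas_mass D [::].
Proof.
move=> uS; move: {2}#|D| (erefl #|D|) => n; elim: n D => [|n IH] D.
  by move/eqP; rewrite cards_eq0 => /eqP ->.
move=> Dn SG DG; have /finset.set0Pn[f fD] : D != finset.set0.
  by rewrite -cards_eq0 Dn.
have SG' : {subset S <= (edges G :\: (D :\ f))%SET}.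
  by move=> e /SG; rewrite !finset.inE negb_and => /andP[-> ->]; rewrite orbT.
apply: (le_trans (IH (D :\ f)%SET _ SG' _)).
- by move: Dn; rewrite (cardsD1 f) fD => -[].
- exact: fintype.subset_trans (finset.subsetDl _ _) DG.
rewrite -{3 4}(finset.setD1K fD); apply: gas_mass_del1 => //.
- by have /fintype.subsetP := DG; apply.
- by rewrite finset.setD11.
- by apply/negP => /SG; rewrite finset.inE fD.
Qed.

End edge_deletion.

(** * Injective graph morphisms *)

Section graph_embedding.
Context (R : realType) (beta : {posnum R}) (G H : sgraph) (h : G -> H).
Hypothesis h_inj : injective h.
Hypothesis h_adj : forall x y, adj x y -> adj (h x) (h y).

Let he (e : {set G}) : {set H} := [set h x | x in e]%SET.
Let hF (F : {set {set G}}) : {set {set H}} := [set he e | e in F]%SET.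

Let he_inj : injective he. Proof. exact: imset_inj. Qed.

Let he2 x y : he [set x; y]%SET = [set h x; h y]%SET.
Proof. by rewrite /he finset.imsetU1 finset.imset_set1. Qed.

Let he_edges e : e \in edges G -> he e \in edges H.
Proof.
move=> /edgesP[x [y [xy ->]]]; rewrite he2; apply/edgesP.
by exists (h x), (h y); split=> //; exact: h_adj.
Qed.

Lemma is_forest_embedding (F : {set {set G}}) : F \subset edges G ->
  is_forest (hF F : subgraph H) = is_forest (F : subgraph G).
Proof.
move=> FG; rewrite /is_forest FG.
have -> /= : hF F \subset edges H.
  apply/fintype.subsetP => _ /imsetP[e eF ->]; apply: he_edges.
  by have /fintype.subsetP := FG; apply.
have hFE : relpre h (fun x y => [set x; y]%SET \in hF F) =2
    (fun x y => [set x; y]%SET \in F).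
  by move=> x y; rewrite /= -he2 mem_imset.
apply: asbool_equiv_eq; split=> acyc c; apply/negP => /andP[c2 /andP[cc uc]].
  have /negP := acyc (map h c); apply; rewrite /is_cycle size_map c2 /=.
  by rewrite /ucycleb cycle_map (eq_cycle hFE) cc map_inj_uniq.
(* Each vertex of a cycle in [hF F] is an endpoint of an image edge, hence an image vertex, so the
   cycle lifts to [G]. *)
have /allP cim : all (mem (codom h)) c.
  apply/allP => x xc; have := next_cycle cc xc => /imsetP[e _ /setP/(_ x)].
  rewrite finset.set21 => /esym/imsetP[y _ ->]; exact: codom_f.
have [c' cE] : exists c', c = map h c'.
  elim: c cim {c2 cc uc} => [|x c IHc] cim; first by exists [::].
  have [|c' ->] := IHc; first by move=> y yc; apply: cim; rewrite inE yc orbT.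
  have /codomP[y ->] := cim x (mem_head _ _).
  by exists (y :: c').
have /negP := acyc c'; apply; move: c2 cc uc; rewrite /is_cycle cE size_map => ->.
by rewrite /ucycleb cycle_map (eq_cycle hFE) map_inj_uniq// => -> ->.
Qed.

(** Deleting from [H] all edges outside the image of [G] leaves a copy of [G] and isolated vertices,
    so the remaining forests are the images of those of [G]. *)
Lemma gas_mass_embedding S : 
  gas_mass beta (edges H :\: hF (edges G))%SET (map he S) =
  gas_mass beta (finset.set0 : {set {set G}}) S.
Proof.
rewrite /gas_mass.
rewrite (bigID (fun F : subgraph H => (F : {set {set H}}) \in codom hF)) /=.
rewrite [X in _ + X]big1 ?addr0; last first.
  move=> F /andP[/andP[dF _] Fcodom]; rewrite /gas_weight; case: ifP => // FF.
  exfalso; move/negP: Fcodom; apply; apply/codomP.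
  move: FF => /andP[FH _].
  exists [set e | he e \in (F : {set {set H}})]%SET; apply/finset.setP => e.
  apply/idP/imsetP => [eF|[e' + ->]]; last by rewrite finset.inE.
  have : e \in hF (edges G).
    apply/negPn/negP => eG; have := disjointFr dF eF.
    rewrite finset.inE eG /=; have /fintype.subsetP := FH.
    by move=> /(_ e eF) ->.
  by move=> /imsetP[e' _ ee']; exists e' => //; rewrite finset.inE -ee'.
pose hinv (F : {set {set H}}) : {set {set G}} := [set e | he e \in F]%SET.
have hFK : cancel hF hinv.
  by move=> F; apply/finset.setP => e; rewrite finset.inE mem_imset.
rewrite (reindex (hF : subgraph G -> subgraph H)); last first.
  by exists hinv => [F _|F /andP[_ /codomP[F' ->]]]; rewrite hFK.
rewrite [LHS]big_mkcond [RHS]big_mkcond; apply: eq_bigr => F _ /=.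
rewrite codom_f andbT all_map !finset.disjoints_subset finset.setC0.
rewrite finset.subsetT /=.
have -> : all (preim he (mem (hF F))) S = all (mem (F : {set {set G}})) S.
  by apply: eq_all => e /=; rewrite mem_imset.
case: (all _ S); rewrite ?andbT ?andbF//.
have hFG : (hF F \subset hF (edges G)) = ((F : {set {set G}}) \subset edges G).
  apply/idP/idP => [FG|]; last exact: imsetS.
  apply/fintype.subsetP => e eF; have /fintype.subsetP := FG.
  by move=> /(_ (he e)); rewrite !mem_imset// => /(_ eF).
rewrite /gas_weight; have [FG|nFG] := boolP ((F : {set {set G}}) \subset edges G).
  have -> : hF F \subset (~: (edges H :\: hF (edges G)))%SET.
    apply/fintype.subsetP => e eF.
    rewrite finset.in_setC finset.in_setD negb_and negbK.
    by move: hFG; rewrite FG => /fintype.subsetP -> //.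
  by rewrite is_forest_embedding// card_imset.
(* Both sides vanish here: if [hF F] avoided the deleted edges and lay in [edges H], then [F] would
   consist of edges of [G]. *)
rewrite [in RHS]/is_forest (negbTE nFG) /=; case: ifP => // sub.
rewrite /is_forest; case: ifP => // /andP[FH _]; exfalso.
move/negP: nFG; apply; rewrite -hFG; apply/fintype.subsetP => e eF.
have /fintype.subsetP/(_ e eF) := sub; rewrite finset.in_setC finset.in_setD.
by have /fintype.subsetP/(_ e eF) -> := FH; rewrite andbT negbK.
Qed.

Lemma gas_embedding (nc : negative_correlation R) (S : seq {set G}) :
  uniq S -> {subset S <= edges G} ->
  (arboreal_gas beta (all_present (map he S)) <=
   arboreal_gas beta (all_present S))%E.
Proof.
move=> uS SG; rewrite !arboreal_gasE lee_fin.
rewrite -[in leRHS](gas_mass_embedding [::]) -gas_mass_embedding /=.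
apply: gas_mass_del => //.
- by rewrite map_inj_uniq.
- move=> _ /mapP[e /SG eG ->]; rewrite !finset.in_setD he_edges// !andbT negbK.
  exact: imset_f.
- exact: finset.subsetDl.
Qed.

End graph_embedding.

(** * Cylinders *)

HB.instance Definition _ (d : nat) := [Countable of lattice_edge d by <:].

Section configurations.
Context (d : nat).
Implicit Types (w : config d) (A B : set (config d)) (S : seq (lattice_edge d)).

(** Numbering the countably many edges gives every configuration a decreasing sequence of basic
    neighbourhoods; see [nbhs_agreeP]. *)
Definition agree (k : nat) w w' :=
  forall e : lattice_edge d, (choice.pickle e < k)%N -> w e = w' e.

Lemma agree_sym k w w' : agree k w w' -> agree k w' w.
Proof. by move=> ww' e /ww' ->. Qed.

Lemma agree_trans k w1 w2 w3 : agree k w1 w2 -> agree k w2 w3 -> agree k w1 w3.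
Proof. by move=> w12 w23 e ek; rewrite w12// w23. Qed.

Lemma agree_leq k l w w' : (k <= l)%N -> agree l w w' -> agree k w w'.
Proof. by move=> kl ww' e ek; apply: ww'; exact: leq_trans kl. Qed.

Definition trunc (k : nat) w : config d := fun e => (choice.pickle e < k)%N && w e.

Lemma agree_trunc k w : agree k (trunc k w) w.
Proof. by move=> e ek; rewrite /trunc ek. Qed.

Lemma agree_truncE k w w' : agree k w w' -> trunc k w = trunc k w'.
Proof.
by move=> ww'; apply/funext => e; rewrite /trunc; case: ltnP => // /ww' ->.
Qed.

Lemma nbhs_agree k w : nbhs w [set w' | agree k w w'].
Proof.
elim: k => [|k IH]; first by apply: filterS filterT => w' _ e.
have : nbhs w [set w' : config d |
    forall e, choice.unpickle k = Some e -> w e = w' e].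
  case: (choice.unpickle k) => [e|]; last by apply: filterS filterT => w' _ e.
  have h : nbhs w (@proj _ (fun _ : lattice_edge d => bool) e @^-1` [set w e]).
    exact: (@proj_continuous _ (fun _ : lattice_edge d => bool) e w).
  by apply: filterS h => w' /= w'e _ [<-].
move=> h; near=> w' => e; rewrite ltnS leq_eqVlt => /predU1P[ek|].
  by apply: (near h w') => //; rewrite -ek choice.pickleK.
by move: e; near: w'.
Unshelve. all: by end_near. Qed.

Lemma nbhs_agreeP w (U : set (config d)) :
  nbhs w U <-> exists k, forall w', agree k w w' -> U w'.
Proof.
split=> [|[k kU]]; last by apply: filterS (nbhs_agree k w) => w' /kU.
(* The sets containing some [agree] class of [w] form a filter that converges to [w] in each
   coordinate, hence in the product topology. *)
pose F : set_system (config d) :=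
  [set V | exists k, forall w', agree k w w' -> V w'].
have FF : Filter F.
  split; first by exists 0%N.
    move=> V1 V2 [k1 h1] [k2 h2]; exists (maxn k1 k2) => w' ww'; split.
      by apply: h1; apply: agree_leq ww'; rewrite leq_maxl.
    by apply: h2; apply: agree_leq ww'; rewrite leq_maxr.
  by move=> V1 V2 V12 [k h]; exists k => w' /h /V12.
suff : F --> w by apply.
apply/cvg_sup => e; apply/cvg_image.
  by rewrite eqEsubset; split=> // b _; exists (fun=> b).
move=> V /nbhs_singleton Vwe; exists [set w' : config d | V (w' e)].
  by exists (choice.pickle e).+1 => w' /(_ e (ltnSn _)) /= <-.
by rewrite eqEsubset; split=> [b [? + <-]//|b Vb]; exists (fun=> b).
Qed.

Lemma config_compact : compact [set: config d].
Proof.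
have := @tychonoff _ (fun _ : lattice_edge d => _) _ (fun=> bool_compact).
by congr (compact _); rewrite eqEsubset.
Qed.

Definition cylinder : set (set (config d)) :=
  [set A | exists k, forall w w', agree k w w' -> A w -> A w'].

Lemma cylinderT : cylinder setT.
Proof. by exists 0%N. Qed.

Lemma cylinderD : setD_closed cylinder.
Proof.
move=> A B [k hA] [l hB]; exists (maxn k l) => w w' ww' [Aw nBw]; split.
  by apply: hA Aw; apply: agree_leq ww'; rewrite leq_maxl.
apply: contra_not nBw; apply: hB; apply: agree_sym.
by apply: agree_leq ww'; rewrite leq_maxr.
Qed.

Lemma cylinderI : setI_closed cylinder.
Proof. by move=> A B cA cB; rewrite -setDD; do 2?apply: cylinderD. Qed.

Lemma cylinder_open A : cylinder A -> open A.
Proof.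
move=> [k kA]; rewrite openE => w Aw; apply/nbhs_agreeP; exists k => w' ww'.
exact: kA Aw.
Qed.

Lemma cylinder_measurable A : cylinder A -> measurable A.
Proof. by move=> /cylinder_open oA; exact: sub_sigma_algebra. Qed.

Lemma measurable_cylinder : @measurable _ (config d) = <<s cylinder >>.
Proof.
apply/seteqP; split; last first.
  by apply: sub_smallest2r; [exact: smallest_sigma_algebra|
                             move=> A /cylinder_open].
apply: smallest_sub; first exact: smallest_sigma_algebra.
(* [V k] is the largest subset of [U] determined by the edges of code below [k]; an open [U] is the
   countable union of these cylinders. *)
move=> U oU; pose V k := [set w | forall w', agree k w w' -> U w'].
have -> : U = \bigcup_k V k.
  apply/seteqP; split=> [w Uw|w [k _]]; last exact.
  move: oU; rewrite openE => /(_ _ Uw)/nbhs_agreeP[k kU].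
  by exists k.
apply: (@sigma_algebra_bigcup _ setT) => k; apply: sub_sigma_algebra.
by exists k => w w' ww' Vw w'' w'w''; apply: Vw; exact: agree_trans w'w''.
Qed.

(** Locality with respect to an explicit list allows induction on the edges: freezing one with [upd]
    removes it from the list. *)
Definition depends_on (Y : Type) S (g : config d -> Y) :=
  forall w w', {in S, w =1 w'} -> g w = g w'.

Definition upd (e : lattice_edge d) (b : bool) w : config d :=
  fun f => if f == e then b else w f.

Lemma upd_id e w : upd e (w e) w = w.
Proof. by apply/funext => f; rewrite /upd; case: eqP => // ->. Qed.

Lemma depends_on_upd (Y : Type) S (g : config d -> Y) e b :
  depends_on (e :: S) g -> depends_on S (g \o upd e b).
Proof.
move=> hg w w' ww'; apply: hg => f; rewrite inE /upd.
by case: eqP => //= _; exact: ww'.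
Qed.

Lemma cylinder_depends_on (Y : Type) S (g : config d -> Y) (B : set Y) :
  depends_on S g -> cylinder (g @^-1` B).
Proof.
move=> hg; exists (\max_(e <- S) choice.pickle e).+1 => w w' ww'.
rewrite /preimage /= (hg w w')// => e eS.
by apply: ww'; rewrite ltnS; exact: leq_bigmax_seq.
Qed.

Definition edges_below (k : nat) : seq (lattice_edge d) :=
  pmap choice.unpickle (iota 0 k).

Lemma agree_edges_below k w w' : {in edges_below k, w =1 w'} -> agree k w w'.
Proof.
move=> ww' e ek; apply: ww'; rewrite mem_pmap; apply/mapP.
by exists (choice.pickle e); rewrite ?choice.pickleK// mem_iota.
Qed.

Definition present S : set (config d) := [set w | all w S].

Lemma cylinder_present S : cylinder (present S).
Proof.
exists (\max_(e <- S) choice.pickle e).+1 => w w' ww' /allP wS; apply/allP => e eS.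
by rewrite -ww' ?wS// ltnS; exact: leq_bigmax_seq.
Qed.

(* The pi-lambda argument for the sets [present S]: a cylinder involves only
   finitely many edges, so no countable unions are needed. *)
Lemma cylinder_ind (Q : set (set (config d))) :
  (forall S, Q (present S)) -> setSD_closed Q -> cylinder `<=` Q.
Proof.
move=> Qp QD A [k kA].
have QT : Q setT by rewrite (_ : setT = present [::])//; exact/seteqP.
have QC B : Q B -> Q (~` B) by move=> QB; rewrite -setTD; exact: QD.
have QU B C : B `&` C = set0 -> Q B -> Q C -> Q (B `|` C).
  move=> BC QB Qc; rewrite -[B `|` C]setCK setCU -setDE; apply: (QC).
  by apply: QD; [apply/disjoints_subset; rewrite setIC|exact: QC|].
(* The list [S] collects the edges already required to be present while the induction removes edges
   from [es]. *)
suff gen (es : seq (lattice_edge d)) B S : depends_on es B ->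
    Q (B `&` present S).
  have := gen (edges_below k) A [::].
  have -> : present [::] = setT by exact/seteqP.
  rewrite setIT; apply=> w w' /agree_edges_below ww'.
  by apply/propext; split; apply: kA => //; exact: agree_sym.
elim: es B S => [|e es IH] B S hB.
  have [[w Bw]|B0] := EM (exists w, B w).
    have -> : B = setT by apply/seteqP; split => // w' _; rewrite (hB w' w).
    by rewrite setTI.
  have -> : B `&` present S = setT `\` setT.
    rewrite setDv; apply/seteqP; split=> // w' [Bw' _]; apply: B0; by exists w'.
  exact: QD.
pose Bb b := B \o upd e b.
have QB b T : Q (Bb b `&` present T) by apply: IH; exact: depends_on_upd.
have BbE b w : w e = b -> Bb b w = B w.
  by move=> <-; rewrite /Bb /= upd_id.
(* Split on the state of [e]; absence of [e] is expressed as a nested difference of presence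
   events. *)
have -> : B `&` present S = (Bb true `&` present (e :: S)) `|`
    ((Bb false `&` present S) `\` (Bb false `&` present (e :: S))).
  apply/seteqP; split=> w.
    move=> [Bw wS]; case we : (w e); [left|right].
      by split; [rewrite BbE|rewrite /present /= we].
    by split; [split=> //; rewrite BbE|case; rewrite /present /= we].
  move=> [[+ /andP[we wS]]|[[+ wS] nwS]]; first by rewrite BbE.
  move=> Bw; split=> //; case we : (w e); last by rewrite BbE in Bw.
  by exfalso; apply: nwS; split=> //; rewrite /present /= we.
apply: QU; [|exact: QB|apply: QD; [|exact: QB|exact: QB]].
  apply/seteqP; split=> // w; rewrite /present /= => -[[_ weS] [[Bw wS] nw]].
  by apply: nw.
by move=> w; rewrite /present /= => -[Bw /andP[]].
Qed.

End configurations.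

(** * The limit probability *)

(* A copy of [config d] whose measurable sets are the cylinders, so that the
   extension theorem for semirings of sets applies. *)
Definition cylinder_config (d : nat) : Type := config d.

HB.instance Definition _ (d : nat) := Pointed.on (cylinder_config d).
HB.instance Definition _ (d : nat) :=
  @isAlgebraOfSets_setD.Build default_measure_display (cylinder_config d)
    (@cylinder d) (@cylinderT d) (@cylinderD d).

(* Cylinders are clopen and the configuration space is compact. *)
Lemma cylinder_bigcup (d : nat) (F : (set (config d))^nat) :
  (forall i, cylinder (F i)) -> cylinder (\bigcup_i F i) ->
  exists N, \bigcup_i F i `<=` \bigcup_(i < N) F i.
Proof.
move=> cF cUF; have /compact_near_coveringP := @config_compact d.
move=> /(_ nat \oo (fun n w => (\bigcup_i F i) w -> (\bigcup_(i < n) F i) w)).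
case=> [w _|N _ /(_ N (leqnn N)) FN]; last by exists N => w; exact: FN.
(* A point of the union has some [F i] as neighbourhood; any other point has the complement of the
   union, again an open cylinder. *)
have [[i _ Fiw]|nFw] := EM ((\bigcup_i F i) w).
  exists (F i, [set n | (i < n)%N]) => /=.
    split; last by exists i.+1.
    exact: open_nbhs_nbhs (conj (cylinder_open (cF i)) Fiw).
  by move=> [w' n] [/= Fiw' ni] _; exists i.
exists (~` \bigcup_i F i, setT) => /=.
  split; last exact: filterT.
  have : cylinder (~` \bigcup_i F i) by 
    by rewrite -setTD; exact: (cylinderD (@cylinderT d)) cUF.
  by move=> /cylinder_open oF; exact: open_nbhs_nbhs (conj oF nFw).
by move=> [w' n] [].
Qed.

Section limit_probability.
Context (R : realType) (d : nat) (Pn : nat -> probability (config d) R).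
Hypothesis cvg_present : forall S : seq (lattice_edge d),
  cvg ((fun n => fine (Pn n (present S))) @ \oo).

Lemma fine_measureSD (P : probability (config d) R) (A B : set (config d)) :
  measurable A -> measurable B -> B `<=` A ->
  fine (P (A `\` B)) = fine (P A) - fine (P B).
Proof.
move=> mA mB BA; rewrite measureD ?ltey_eq ?fin_num_measure// setIidr//.
by rewrite fineB ?fin_num_measure.
Qed.

(** Probabilities subtract over nested differences, so [cylinder_ind] carries convergence over from
    presence events; measurability is carried along for the subtraction formula. *)
Lemma cvg_cylinder (A : set (config d)) :
  cylinder A -> cvg ((fun n => fine (Pn n A)) @ \oo).
Proof.
suff : @cylinder d `<=` [set A : set (config d) | measurable A /\
    cvg ((fun n => fine (Pn n A)) @ \oo)] by move=> h /h[].
apply: cylinder_ind => [S|A' B BA [mA cA] [mB cB]].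
  split; last exact: cvg_present.
  exact: (cylinder_measurable (cylinder_present S)).
split; first exact: measurableD.
under eq_fun do rewrite fine_measureSD//.
exact: is_cvgB.
Qed.

(* The limit exists only for cylinders; the absolute value makes [mu]
   nonnegative also on the other sets, where [lim] may be a junk value. *)
Let mu (A : set (cylinder_config d)) : \bar R :=
  (`|lim ((fun n => fine (Pn n A)) @ \oo)|)%:E.

Let cvg_mu A : cylinder A -> (fun n => Pn n A) @ \oo --> mu A.
Proof.
move=> cA; have mA := cylinder_measurable cA.
apply/fine_cvgP; split; first by near=> n; exact: fin_num_measure.
have /cvg_norm := cvg_cylinder cA.
apply: cvg_trans; apply: near_eq_cvg; near=> n.
by rewrite /= ger0_norm// fine_ge0.
Unshelve. all: by end_near. Qed.

Let mu0 : mu set0 = 0%E.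
Proof.
rewrite /mu (_ : (fun n => _) = cst 0) ?lim_cst ?normr0//.
by apply/funext => n; rewrite measure0.
Qed.

Let mu_ge0 A : (0 <= mu A)%E.
Proof. by rewrite lee_fin. Qed.

Let mu_sigma_additive : semi_sigma_additive mu.
Proof.
move=> F mF tF mUF.
have [N FN] := cylinder_bigcup mF mUF.
(* For [n >= N] the first [n] sets already make up the union, so only the finite additivity of each
   [Pn k] has to pass to the limit. *)
apply: cvg_near_cst; near=> n.
apply: (@cvg_unique _ _ ((fun k => Pn k (\bigcup_i F i)) @ \oo)) => //;
  last exact: cvg_mu.
rewrite (_ : (fun k => _) = fun k => (\sum_(0 <= i < n) Pn k (F i))%E).
  apply: cvg_nnesum => [i _|i _].
    by near=> k; exact: measure_ge0.
  exact: cvg_mu (mF i).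
apply/funext => k; rewrite big_mkord -measure_semi_additive//.
- congr (Pn k _); rewrite -bigcup_mkord; apply/seteqP; split.
    apply: subset_trans FN _ => w [i /= iN Fiw]; exists i => //=.
    by apply: leq_trans iN _; near: n; exists N.
  by move=> w [i _ Fiw]; exists i.
- by move=> i; exact: (cylinder_measurable (mF i)).
- by apply: bigsetU_measurable => i _; exact: (cylinder_measurable (mF i)).
Unshelve. all: by end_near. Qed.

(** [P] is the Carathéodory extension of [mu] to the sigma-algebra generated by the cylinders, which
    is the Borel one. *)
Lemma limit_probability : exists P : probability (config d) R,
  forall A, cylinder A -> (fun n => fine (Pn n A)) @ \oo --> fine (P A).
Proof.
pose m : {measure set (cylinder_config d) -> \bar R} :=
  HB.pack mu (isMeasure.Build _ _ _ mu mu0 mu_ge0 mu_sigma_additive).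
pose P0 : set (config d) -> \bar R := measure_extension m.
have P0E A : cylinder A -> P0 A = mu A := @measurable_mu_extE _ _ _ m A.
have P00 : P0 set0 = 0%E by exact: (measure0 (measure_extension m)).
have P0_ge0 A : (0 <= P0 A)%E by exact: (measure_ge0 (measure_extension m)).
have P0_sigma_additive : semi_sigma_additive P0.
  move=> F mF tF mUF; apply: (@measure_semi_sigma_additive _ _ _
    (measure_extension m)) => //; last by rewrite measurable_cylinder in mUF.
  by move=> i; have := mF i; rewrite measurable_cylinder.
have P0T : P0 setT = 1%E.
  rewrite P0E; last exact: cylinderT.
  apply: (@cvg_unique _ _ ((fun k => Pn k setT) @ \oo)) => //.
    exact/cvg_mu/cylinderT.
  by apply: cvg_near_cst; near=> k; exact: probability_setT.
pose P1 : {measure set (config d) -> \bar R} :=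
  HB.pack P0 (isMeasure.Build _ _ _ P0 P00 P0_ge0 P0_sigma_additive).
pose P : probability (config d) R :=
  HB.pack P0 (Measure.on P1) (Measure_isProbability.Build _ _ _ P1 P0T).
exists P => A cA; have -> : P A = mu A by exact: P0E.
by have /fine_cvgP[] := cvg_mu cA.
Unshelve. all: by end_near. Qed.

End limit_probability.

(** * Weak convergence and translation invariance *)

Section weak_convergence.
Context (R : realType) (d : nat).
Implicit Types (P : probability (config d) R) (g : config d -> R).

Lemma depends_on_integrable P S g (A : set (config d)) :
  measurable A -> bounded_fun g -> depends_on S g ->
  P.-integrable A (EFin \o g).
Proof.
move=> mA [M [Mr gM]] gS; apply: measurable_bounded_integrable => //.
- by rewrite ltey_eq fin_num_measure.
- move=> _ Y _; apply: measurableI => //.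
  by apply: cylinder_measurable; exact: cylinder_depends_on gS.
- by exists M; split=> // x Mx y _; exact: gM.
Qed.

Lemma bounded_fun_comp g (h : config d -> config d) :
  bounded_fun g -> bounded_fun (g \o h).
Proof. by move=> [M [Mr gM]]; exists M; split=> // x Mx y _; exact: gM. Qed.

Lemma continuous_trunc g (eps : R) : continuous g -> 0 < eps ->
  exists k, forall w, `|g w - g (trunc k w)| <= eps.
Proof.
move=> cg eps0; have /compact_near_coveringP := @config_compact d.
move=> /(_ nat \oo (fun k w => `|g w - g (trunc k w)| <= eps)).
case=> [w _|k _ /(_ k (leqnn k)) gk]; last by exists k => w; exact: gk.
(* For [w'] near [w] and large [n], both [w'] and [trunc n w'] agree with [w] below [k], so each
   costs [eps / 2]. *)
have e20 : 0 < eps / 2 by rewrite divr_gt0.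
have /cvgrPdist_lt /(_ _ e20) /nbhs_agreeP[k kw] := cg w.
exists ([set w' | agree k w w'], [set n | (k <= n)%N]) => /=.
  by split; [exact: nbhs_agree|exists k].
move=> [w' n] [/= ww' kn].
rewrite (le_trans (ler_distD (g w) _ _))// (splitr eps) lerD// ltW//.
  by rewrite distrC; exact: kw.
apply: kw; apply: agree_trans ww' _; apply: agree_sym.
by apply: agree_leq kn _; exact: agree_trunc.
Qed.

Section cylinder_convergence.
Context (Pn : nat -> probability (config d) R) (P : probability (config d) R).
Hypothesis cvgP : forall A, cylinder A ->
  (fun n => fine (Pn n A)) @ \oo --> fine (P A).

(** Splitting [A] on the state of the first edge freezes that edge in [g]. With no edges left, [g]
    is constant and only the probability of a cylinder remains. *)
Lemma cvg_Rintegral_depends_on S g (A : set (config d)) :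
  cylinder A -> bounded_fun g -> depends_on S g ->
  (\int[Pn n]_(w in A) g w)%R @[n --> \oo] --> (\int[P]_(w in A) g w)%R.
Proof.
elim: S g A => [|e S IH] g A cA bg gS.
  have gE (Q : probability (config d) R) :
      \int[Q]_(w in A) g w = g point * fine (Q A) :> R.
    rewrite -Rintegral_cst; last exact: cylinder_measurable.
    by apply: eq_Rintegral => w _; exact: gS.
  rewrite gE; under eq_fun do rewrite gE.
  by apply: cvgM; [exact: cvg_cst|exact: cvgP].
pose Ab b := A `&` [set w | w e = b].
have cAb b : cylinder (Ab b).
  apply: cylinderI => //.
  by apply: (@cylinder_depends_on _ _ [:: e] (fun w => w e) [set b]) => w w'; apply;
    rewrite inE.
have AE : A = Ab true `|` Ab false.
  rewrite -setIUr; apply/esym/setIidl => w _ /=.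
  by case: (w e); [left|right].
have dAb : [disjoint Ab true & Ab false].
  by apply/eqP/seteqP; split=> // w [[_ /= we] [_]] /=; rewrite we.
have gE (Q : probability (config d) R) : \int[Q]_(w in A) g w =
    \int[Q]_(w in Ab true) (g \o upd e true) w + \int[Q]_(w in Ab false) (g \o upd e false) w :> R.
  rewrite {1}AE Rintegral_setU//; [|exact: cylinder_measurable..|]; last first.
    rewrite -AE; apply: depends_on_integrable gS => //.
    exact: cylinder_measurable.
  congr (_ + _); apply: eq_Rintegral => w; rewrite inE => -[_ /= we].
    by rewrite -we upd_id.
  by rewrite -we upd_id.
rewrite gE; under eq_fun do rewrite gE.
by apply: cvgD; apply: IH; [exact: cAb|exact: bounded_fun_comp|
  exact: depends_on_upd|exact: cAb|exact: bounded_fun_comp|exact: depends_on_upd].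
Qed.

Lemma weak_cvg_cylinder : weak_cvg Pn P.
Proof.
move=> f cf bf.
have dtr k : depends_on (edges_below d k) (f \o trunc k).
  by move=> w w' /agree_edges_below/agree_truncE /= ->.
(* By continuity [f] is the pointwise limit of its truncations, which are cylinder functions. *)
have mf : measurable_fun setT f.
  apply: (@measurable_realfun.measurable_fun_cvg _ _ _ _ (fun k => f \o trunc k)) => [k|w _].
    move=> _ Y _; rewrite setTI.
    by apply: cylinder_measurable; exact: cylinder_depends_on (dtr k).
  apply/cvgrPdist_lt => eps eps0.
  have /cvgrPdist_lt /(_ _ eps0) /nbhs_agreeP[k kw] := cf w.
  exists k => // n /= kn; apply: kw; apply: agree_sym.
  by apply: agree_leq kn _; exact: agree_trunc.
have intf (Q : probability (config d) R) : Q.-integrable setT (EFin \o f).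
  apply: measurable_bounded_integrable => //.
  by rewrite ltey_eq fin_num_measure.
have inttr k (Q : probability (config d) R) :
    Q.-integrable setT (EFin \o (f \o trunc k)).
  by apply: depends_on_integrable (dtr k) => //; exact: bounded_fun_comp.
have close (Q : probability (config d) R) k eps :
    (forall w, `|f w - f (trunc k w)| <= eps) ->
    `|\int[Q]_w f w - \int[Q]_w (f \o trunc k) w| <= eps.
  move=> fk; rewrite -RintegralB//; [|exact: intf|exact: inttr].
  have intB : Q.-integrable setT (EFin \o (fun w => f w - (f \o trunc k) w)).
    by have := integrableB measurableT (intf Q) (inttr k Q).
  apply: le_trans (le_normr_Rintegral _ intB) _ => //.
  have epsE : \int[Q]_w (cst eps w) = eps.
    rewrite Rintegral_cst// [X in fine X](_ : _ = 1%E) ?mulr1//.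
    exact: probability_setT.
  rewrite -[leRHS]epsE.
  apply: le_Rintegral => //.
  - exact: integrable_norm.
  - by apply: finite_measure_integrable_cst.
apply/cvgrPdist_lt => eps eps0.
(* Two truncation errors and one convergence error, each at most [eps / 4], stay strictly below
   [eps]. *)
have e40 : 0 < eps / 4 by rewrite divr_gt0.
have [k fk] := continuous_trunc cf e40.
have /cvgrPdist_lt /(_ _ e40) := cvg_Rintegral_depends_on (@cylinderT d)
  (bounded_fun_comp (trunc k) bf) (dtr k).
apply: filterS => n; have := close (Pn n) _ _ fk; have := close P _ _ fk.
set a := \int[P]_w f w; set b := \int[P]_w _; set u := \int[Pn n]_w f w.
set v := \int[Pn n]_w _ => ab uv bv.
have -> : a - u = (a - b) + (b - v) - (u - v) by lra.
move: ab uv bv; rewrite !ler_norml !ltr_norml => /andP[? ?] /andP[? ?] /andP[? ?].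
by apply/andP; split; lra.
Qed.

End cylinder_convergence.

(** Equality extends to cylinders by [cylinder_ind], then to Borel sets because cylinders are a
    generating class stable under intersection. *)
Lemma probability_eq_present (P Q : probability (config d) R) :
  (forall S : seq (lattice_edge d), P (present S) = Q (present S)) ->
  forall A, measurable A -> P A = Q A.
Proof.
move=> PQ A mA.
have PQcyl B : cylinder B -> P B = Q B.
  suff : @cylinder d `<=` [set A | measurable A /\ P A = Q A] by move=> h /h[].
  apply: cylinder_ind => [S|C D DC [mC PQC] [mD PQD]].
    by split=> //; apply: cylinder_measurable; exact: cylinder_present.
  split; first exact: measurableD.
  by rewrite !measureD ?ltey_eq ?fin_num_measure// setIidr//; congr (_ - _)%E.
apply: (@measure_unique _ _ _ (@cylinder d) (fun=> setT)) => //.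
- exact: measurable_cylinder.
- exact: cylinderI.
- by move=> _; exact: cylinderT.
- by apply/seteqP; split=> // w _; exists 0%N.
- by move=> _; rewrite ltey_eq fin_num_measure.
Qed.

Lemma preimage_shift_present (v : 'rV[int]_d) S :
  shift_config v @^-1` present S = present (map (shift_edge v) S).
Proof. by apply/seteqP; split=> w; rewrite /present /= all_map. Qed.

Lemma measurable_shift_config (v : 'rV[int]_d) :
  measurable_fun setT (shift_config v).
Proof.
apply: (measurability _ (@measurable_cylinder d)) => _ [B cB <-].
rewrite setTI; move: B cB; apply: cylinder_ind => [S|A B BA mA mB] /=.
  rewrite preimage_shift_present.
  by apply: cylinder_measurable; exact: cylinder_present.
exact: (measurableD mA mB).
Qed.

Lemma translation_invariant_present (P : probability (config d) R) :
  (forall (v : 'rV[int]_d) (S : seq (lattice_edge d)),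
    P (present (map (shift_edge v) S)) = P (present S)) ->
  translation_invariant P.
Proof.
move=> PS v A mA.
(* The image of [P] under the shift is again a probability, so it is enough to compare it with [P]
   on presence events. *)
pose shift : {mfun config d >-> config d} :=
  HB.pack (shift_config v) (isMeasurableFun.Build _ _ _ _ (shift_config v)
    (measurable_shift_config v)).
rewrite -[LHS]/(distribution P shift A).
apply: probability_eq_present => // S.
by rewrite -(PS v S) -preimage_shift_present.
Qed.

End weak_convergence.

(** * The gas on boxes of the lattice *)

Section lattice_gas.
Context (R : realType) (d : nat) (beta : {posnum R}).
Implicit Types (L : {fset 'rV[int]_d}) (S : seq (lattice_edge d)).

(** The trace of [e] on [L]; it represents [e] faithfully only when both endpoints lie in [L]. *)
Definition local_edge L (e : lattice_edge d) : {set induced_sgraph L} :=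
  [set x : L | val x \in val e]%SET.

Definition edges_within L S := all (fun e => val e `<=` L)%fset S.

Lemma local_edgeK L (e : lattice_edge d) : (val e `<=` L)%fset ->
  val e = [fset val x | x in local_edge L e]%fset.
Proof.
move=> /fsubsetP eL; apply/fsetP => x; apply/idP/imfsetP => [xe|[y /= + ->]].
  by exists [` eL x xe]%fset; rewrite //= finset.inE.
by rewrite finset.inE.
Qed.

Lemma local_edge_inj L S : edges_within L S -> {in S &, injective (local_edge L)}.
Proof.
move=> /allP SL e f /SL eL /SL fL ef; apply/val_inj.
by rewrite (local_edgeK eL) (local_edgeK fL) ef.
Qed.

Lemma local_edge_edges L (e : lattice_edge d) : (val e `<=` L)%fset ->
  local_edge L e \in edges (induced_sgraph L).
Proof.
move=> /fsubsetP eL; have /is_lattice_edgeP[x [y [xy eE]]] := valP e.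
have xL : x \in L by apply: eL; rewrite eE fset21.
have yL : y \in L by apply: eL; rewrite eE fset22.
apply/edgesP; exists [` xL]%fset, [` yL]%fset; split; first exact: xy.
by apply/finset.setP => z; rewrite !finset.inE eE in_fset2 -!val_eqE.
Qed.

Lemma config_of_local_edge L (F : subgraph (induced_sgraph L))
    (e : lattice_edge d) : (val e `<=` L)%fset ->
  config_of F e = (local_edge L e \in (F : {set {set L}})).
Proof.
move=> eL; apply/existsP/idP => [[f /andP[fF /eqP ef]]|eF]; last first.
  by exists (local_edge L e); rewrite eF; apply/eqP; exact: local_edgeK.
suff -> : local_edge L e = f by [].
apply/finset.setP => x; rewrite finset.inE ef; apply/imfsetP/idP => [[y /= yf]|xf].
  by move=> /val_inj ->.
by exists x.
Qed.

Lemma lattice_gas_present L S : edges_within L S ->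
  lattice_gas beta L (present S) =
  arboreal_gas beta (@all_present (induced_sgraph L) (map (local_edge L) S)).
Proof.
move=> /allP SL; rewrite /lattice_gas /distribution /pushforward /=.
congr (arboreal_gas _ _); apply/seteqP; split=> F; rewrite /present /=.
  move=> /allP h _ /mapP[e eS ->].
  by rewrite -config_of_local_edge; [exact: h|exact: SL].
move=> h; apply/allP => e eS; rewrite config_of_local_edge; last exact: SL.
by apply: h; exact: map_f.
Qed.

Lemma present_undup S : present (undup S) = present S.
Proof. by apply/seteqP; split=> w; rewrite /present /= all_undup. Qed.

(** Translation by [v] is an injective morphism between the induced graphs; [v = 0] gives the
    inclusion of one box in another. *)
Lemma lattice_gas_shift_le (nc : negative_correlation R) L1 L2 (v : 'rV[int]_d) S :
  (forall x, x \in L1 -> v + x \in L2) -> edges_within L1 S ->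
  (lattice_gas beta L2 (present (map (shift_edge v) S)) <=
   lattice_gas beta L1 (present S))%E.
Proof.
(* Negative correlation concerns distinct edges, so repetitions are removed first; this does not
   change the event. *)
move=> vL SL; rewrite -(present_undup S) -preimage_shift_present.
rewrite -(present_undup S) preimage_shift_present.
have {SL} : edges_within L1 (undup S) by rewrite /edges_within all_undup.
move: (undup_uniq S); move: (undup S) => {}S uS SL.
pose h (x : L1) : L2 := [` vL _ (valP x)]%fset.
have h_inj : injective h.
  by move=> x y [] /addrI /val_inj.
have SL2 : edges_within L2 (map (shift_edge v) S).
  apply/allP => _ /mapP[e /(allP SL)/fsubsetP eL ->].
  by apply/fsubsetP => _ /imfsetP[x /= xe ->]; apply: (vL); exact: eL.
rewrite !lattice_gas_present//.
have -> : map (local_edge L2) (map (shift_edge v) S) =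
    map (fun e : {set L1} => [set h x | x in e]%SET) (map (local_edge L1) S).
  rewrite -!map_comp; apply/eq_in_map => e eS /=.
  apply/finset.setP => y; rewrite finset.inE; apply/imfsetP/imsetP => /=.
    move=> [x xe yE]; have xL : x \in L1.
      by move: x xe {yE}; apply/fsubsetP; exact: (allP SL).
    by exists [` xL]%fset; [rewrite finset.inE|apply/val_inj; exact: yE].
  move=> [x + ->]; rewrite finset.inE => xe; by exists (val x).
apply: (@gas_embedding _ _ (induced_sgraph L1) (induced_sgraph L2) h) => //.
- by move=> x y; rewrite /= /induced_adj /= lattice_adjD.
- by rewrite map_inj_in_uniq//; exact: local_edge_inj SL.
- by move=> _ /mapP[e /(allP SL) eL ->]; exact: local_edge_edges.
Qed.

End lattice_gas.

Lemma shift_edge0 (d : nat) (e : lattice_edge d) : shift_edge 0 e = e.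
Proof.
apply/val_inj/fsetP => x; apply/imfsetP/idP => [[y /= ye ->]|xe].
  by rewrite add0r.
by exists x; rewrite ?add0r.
Qed.

Lemma shift_edgeK (d : nat) (v : 'rV[int]_d) :
  cancel (shift_edge v) (shift_edge (- v)).
Proof.
move=> e; apply/val_inj/fsetP => x; apply/imfsetP/idP => /=.
  move=> [_ /imfsetP[z /= ze ->] ->].
  by rewrite addKr.
by move=> xe; exists (v + x); rewrite ?addKr//=; apply/imfsetP; exists x.
Qed.

Theorem proposition1p9 (R : realType) (d : nat)
    (nc : negative_correlation R) (beta : {posnum R})
    (L : nat -> {fset 'rV[int]_d})
    (L_connected : forall n, graph_connected (induced_sgraph (L n)))
    (L_increasing : forall n, (L n `<=` L n.+1)%fset)
    (L_exhaustive : forall A : {fset 'rV[int]_d},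
       exists N : nat, forall n, (N <= n)%N -> (A `<=` L n)%fset) :
  exists P : probability (config d) R,
    weak_cvg (fun n => lattice_gas beta (L n)) P /\ translation_invariant P.
Proof.
have mp S : measurable (@present d S).
  by apply: cylinder_measurable; exact: cylinder_present.
pose p S n := fine (lattice_gas beta (L n) (@present d S)).
have p_shift_le v S m n : (forall x, x \in L n -> v + x \in L m) ->
    edges_within (L n) S -> p (map (shift_edge v) S) m <= p S n.
  move=> vL SL; apply: fine_le; rewrite ?fin_num_measure//.
  exact: lattice_gas_shift_le.
have edges_withinP S : exists N, forall n, (N <= n)%N -> edges_within (L n) S.
  have [N LN] := L_exhaustive (\bigcup_(e <- S) val e)%fset.
  exists N => n /LN SL; apply/allP => e eS; apply: fsubset_trans SL.
  exact: (@bigfcup_sup _ _ _ _ xpredT val eS).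
have p_le S N m n : (forall k, (N <= k)%N -> edges_within (L k) S) ->
    (N <= n)%N -> (n <= m)%N -> p S m <= p S n.
  move=> SN Nn nm; rewrite -{1}(map_id S) -(eq_map (@shift_edge0 d)).
  apply: p_shift_le => [x|]; last exact: SN.
  rewrite add0r; move: x; apply/fsubsetP; elim: m nm => [|m IHm].
    by rewrite leqn0 => /eqP ->.
  rewrite leq_eqVlt => /predU1P[->//|]; rewrite ltnS => /IHm.
  by move=> /fsubset_trans; apply.
have p_cvg S : cvg (p S @ \oo).
  (* Monotonicity starts only once the boxes contain all edges of [S]; 0 is the lower bound. *)
  have [N SN] := edges_withinP S; apply: (@near_nonincreasing_is_cvgn _ _ 0).
    by exists N => // n /= Nn m nm; exact: (p_le _ N).
  by apply: nearW => n; rewrite fine_ge0.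
have [P Pcyl] := limit_probability p_cvg.
exists P; split; first exact: weak_cvg_cylinder.
have Pp S : p S @ \oo --> fine (P (present S)) by apply/Pcyl/cylinder_present.
have P_shift_le v S :
    fine (P (present (map (shift_edge v) S))) <= fine (P (present S)).
  have [N SN] := edges_withinP S.
  have [M SM] := edges_withinP (map (shift_edge v) S).
  rewrite -(cvg_lim _ (Pp S))//; apply: limr_ge; first exact: p_cvg.
  exists N => // n /= Nn; have [K LK] := L_exhaustive [fset (v + x)%R | x in L n]%fset.
  (* Beyond [K] the box contains the translate of [L n]; beyond [M] it contains the translated
     edges, so their probability decreases to its limit. *)
  apply: (@le_trans _ _ (p (map (shift_edge v) S) (maxn K M))); last first.
    apply: p_shift_le => [x xL|]; last exact: SN.
    by have /fsubsetP := LK _ (leq_maxl K M); apply; apply/imfsetP; exists x.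
  rewrite -(cvg_lim _ (Pp (map (shift_edge v) S)))//; apply: limr_le.
    exact: p_cvg.
  by exists (maxn K M) => // m /= Km; apply: (p_le _ M) => //; exact: leq_maxr.
apply: translation_invariant_present => v S.
rewrite -[LHS]fineK ?fin_num_measure// -[RHS]fineK ?fin_num_measure//.
apply/eqP; rewrite eqe eq_le P_shift_le /=.
(* The reverse inequality is the same one for [- v] and the translated list. *)
by rewrite -{1}(mapK (shift_edgeK v) S) P_shift_le.
Qed.
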